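(* Let $\mu$ and $\nu$ be probability measures on $\mathbb{R}^d$ and let $X\sim\mu$, $Y\sim\nu$. Suppose that, for some $n\in\{0,1,2,\dots\}$, $\mu$ and $\nu$ have finite $(n+2)$th moments and condition $\mathbf{M}(n)$ holds. Then $$\lim_{t\to\infty}t^{\frac{n+1}{2}}\,d_{\mathrm{TV}}(\mu*\rho_t,\nu*\rho_t)=\frac12\int_{\mathbb{R}^d}\bigg|\sum_{\alpha\in[n+1]}\frac{1}{\alpha!}\big(\mathbb{E}X^\alpha-\mathbb{E}Y^\alpha\big)H_\alpha(x)\bigg|\,\mathfrak{g}(dx).$$
   Context: For $t>0$, $\rho_t(x)=(2\pi t)^{-d/2}e^{-|x|^2/(2t)}$, $x\in\mathbb{R}^d$, and $\mu*\rho_t$ denotes convolution (identified with its Lebesgue density). $\mathfrak{g}(dx)=\rho_1(x)\,dx$ is the standard Gaussian measure on $\mathbb{R}^d$. For probability measures with Lebesgue densities (denoted by the same symbols), $d_{\mathrm{TV}}(\mu,\nu)=\frac12\int|\mu-\nu|\,dx$. Multi-index notation: for $\alpha\in\mathbb{N}^d$ ($\mathbb{N}$ includes $0$) and $y\in\mathbb{R}^d$, $y^\alpha=\prod_i y_i^{\alpha_i}$, $\alpha!=\prod_i\alpha_i!$, and $[j]=\{\alpha\in\mathbb{N}^d:\sum_i\alpha_i=j\}$. The Hermite polynomials are $H_m(x)=(-1)^m e^{x^2/2}\frac{d^m}{dx^m}e^{-x^2/2}$ for $x\in\mathbb{R}$, $m\in\mathbb{N}$, and $H_\alpha(x)=\prod_{i=1}^d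 H_{\alpha_i}(x_i)$ for $x\in\mathbb{R}^d$, $\alpha\in\mathbb{N}^d$. Condition $\mathbf{M}(n)$: $n$ is the largest nonnegative integer such that $\mathbb{E}X^\alpha=\mathbb{E}Y^\alpha$ for all $\alpha\in[k]$ and all $k\le n$; i.e. all moments of order at most $n$ match, but $\mathbb{E}X^\alpha\ne\mathbb{E}Y^\alpha$ for some $\alpha\in[n+1]$. *)

(* Defs.v *)
From HB Require Import structures.
From mathcomp Require Import all_boot all_order all_algebra.
From mathcomp Require Import all_classical all_reals all_analysis.
From mathcomp Require Import measurable_realfun.

Set Implicit Arguments.
Unset Strict Implicit.
Unset Printing Implicit Defensive.

Import Order.TTheory GRing.Theory Num.Theory.
Import numFieldNormedType.Exports.

Local Open Scope classical_set_scope.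
Local Open Scope ring_scope.

Section power_measure.
Context {dT : measure_display} {T : measurableType dT} {R : realType}.

Definition vcons d (p : T * d.-tuple T) : d.+1.-tuple T :=
  [tuple of p.1 :: p.2].

Definition vuncons d (x : d.+1.-tuple T) : T * d.-tuple T :=
  (tnth x ord0, [tuple of behead x]).

Lemma vconsK d : cancel (@vcons d) (@vuncons d).
Proof. by case=> a x; congr pair; exact: val_inj. Qed.

Lemma vunconsK d : cancel (@vuncons d) (@vcons d).
Proof. by move=> x; rewrite [RHS]tuple_eta; exact: val_inj. Qed.

Lemma measurable_vcons d : measurable_fun setT (@vcons d).
Proof.
by apply: measurable_cons; [exact: measurable_fst|exact: measurable_snd].
Qed.

Lemma measurable_vuncons d : measurable_fun setT (@vuncons d).
Proof.
apply: measurable_fun_pair; first exact: measurable_tnth.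
exact: measurable_behead.
Qed.

Section step.
Variables (m1 : {sigma_finite_measure set T -> \bar R}) (d : nat)
  (m2 : {sigma_finite_measure set (d.-tuple T) -> \bar R}).

Definition power_measure_step : set (d.+1.-tuple T) -> \bar R :=
  pushforward (m1 \x m2)%E (@vcons d).

Let step0 : power_measure_step set0 = 0%E.
Proof. by rewrite /power_measure_step /pushforward preimage_set0 measure0. Qed.

Let step_ge0 A : (0 <= power_measure_step A)%E.
Proof. by rewrite /power_measure_step /pushforward measure_ge0. Qed.

Let step_sigma_additive : semi_sigma_additive power_measure_step.
Proof.
move=> F mF tF mUF; rewrite /power_measure_step /pushforward preimage_bigcup.
have mv B : measurable B -> measurable (@vcons d @^-1` B).
  by move=> mB; rewrite -[X in measurable X]setTI; exact: measurable_vcons.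
apply: measure_semi_sigma_additive.
- by move=> i; exact: mv.
- apply/trivIsetP => i j _ _ ij; rewrite -preimage_setI.
  by move/trivIsetP : tF => ->//; rewrite preimage_set0.
- by rewrite -preimage_bigcup; exact: mv.
Qed.

HB.instance Definition _ := isMeasure.Build _ _ _ power_measure_step
  step0 step_ge0 step_sigma_additive.

Let step_sigma_finite : sigma_finite setT power_measure_step.
Proof.
have /sigma_finiteP[F [TF ndF Foo]] := sigma_finiteT m1.
have /sigma_finiteP[G [TG ndG Goo]] := sigma_finiteT m2.
exists (fun n => @vuncons d @^-1` (F n `*` G n)).
  apply/seteqP; split => // x _.
  have [i _ Fi] : (\bigcup_n F n) (tnth x ord0) by rewrite -TF.
  have [j _ Gj] : (\bigcup_n G n) [tuple of behead x] by rewrite -TG.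
  exists (maxn i j) => //; split => /=.
  - by move: Fi; exact/subsetPset/ndF/leq_maxl.
  - by move: Gj; exact/subsetPset/ndG/leq_maxr.
move=> k; have [mF Fk] := Foo k; have [mG Gk] := Goo k; split.
  rewrite -[X in measurable X]setTI; apply: measurable_vuncons => //.
  exact: measurableX.
rewrite /power_measure_step /pushforward -comp_preimage.
rewrite [X in X @^-1` _](_ : _ = id); last first.
  by apply/funext => x /=; rewrite vconsK.
by rewrite preimage_id product_measure1E// lte_mul_pinfty// ge0_fin_numE.
Qed.

HB.instance Definition _ := Measure_isSigmaFinite.Build _ _ _
  power_measure_step step_sigma_finite.

End step.

(* The d-fold product of m with itself; [power_measure_box] characterizes it. *)
Fixpoint power_measure (m : {sigma_finite_measure set T -> \bar R}) d :
    {sigma_finite_measure set (d.-tuple T) -> \bar R} :=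
  if d is d'.+1 then power_measure_step m (power_measure m d')
  else \d_[tuple].

Lemma power_measure_box m d (A : 'I_d -> set T) :
  (forall i, measurable (A i)) ->
  power_measure m d [set x | forall i, A i (tnth x i)] =
    (\prod_(i < d) m (A i))%E.
Proof.
elim: d A => [A _|d IH A mA] /=.
  by rewrite big_ord0 diracE mem_set// => -[].
rewrite big_ord_recl -IH; last by move=> i; exact: mA.
rewrite -product_measure1E//; last first.
  rewrite (_ : [set x | _] =
    \bigcap_(i in [set: 'I_d]) ((fun x => tnth x i) @^-1` A (lift ord0 i))).
    apply: fin_bigcap_measurable => // i _.
    by rewrite -[X in measurable X]setTI; exact: measurable_tnth.
  by apply/seteqP; split => x /= H i; [move=> _|]; exact: H.
rewrite /power_measure_step /pushforward; congr (_ _).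
apply/seteqP; split => -[a x] /= H.
  split; first by have := H ord0; rewrite tnth0.
  by move=> i; have := H (lift ord0 i); rewrite tnthS.
move=> i; case: (unliftP ord0 i) => [j ->|->]; last by rewrite tnth0; case: H.
by rewrite tnthS; exact: H.2.
Qed.

End power_measure.

(* R^d with its Borel sigma-algebra. [measurableTypeR R] is [R] with the
   sigma-algebra that carries [lebesgue_measure]. *)
Notation Rvec R d := (d.-tuple (measurableTypeR R)).

Definition lebesgue_vec {R : realType} d :
    {sigma_finite_measure set (Rvec R d) -> \bar R} :=
  power_measure (@lebesgue_measure R) d.

Section euclidean_space.
Context {R : realType} {d : nat}.
Implicit Types x y : Rvec R d.

Definition vcoord (i : 'I_d) x : R := tnth x i.

Definition subv x y : Rvec R d := [tuple vcoord i x - vcoord i y | i < d].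

Definition enorm x : R := Num.sqrt (\sum_(i < d) vcoord i x ^+ 2).

Definition heat_kernel (t : R) x : R :=
  (2 * pi * t) `^ (- (d%:R / 2)) * expR (- (enorm x ^+ 2 / (2 * t))).

Lemma measurable_vcoord i : measurable_fun setT (vcoord i).
Proof. exact: measurable_tnth. Qed.

Lemma measurable_heat_kernel t : measurable_fun setT (heat_kernel t).
Proof.
apply: measurable_funM => //; apply: measurableT_comp => //.
apply: measurableT_comp => //; apply: measurable_funM => //.
rewrite (_ : (fun x => _) = fun x => \sum_(i < d) vcoord i x ^+ 2).
  apply: measurable_sum => i.
  by apply: measurable_funX; exact: measurable_vcoord.
apply/funext => x; rewrite sqr_sqrtr// sumr_ge0// => i _.
exact: sqr_ge0.
Qed.

Lemma heat_kernel_ge0 t x : 0 <= heat_kernel t x.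
Proof. by rewrite mulr_ge0 ?powR_ge0 ?expR_ge0. Qed.

(* The Lebesgue density of mu * (f dx), for a measure mu and a function f. *)
Definition conv_density (mu : {measure set (Rvec R d) -> \bar R})
    (f : Rvec R d -> R) x : R :=
  \int[mu]_y f (subv x y).

(* Total variation distance between the probability measures with Lebesgue
   densities f and g. *)
Definition d_TV (f g : Rvec R d -> R) : \bar R :=
  ((2^-1)%:E * \int[lebesgue_vec d]_x `|f x - g x|%:E)%E.

Definition std_gaussian (A : set (Rvec R d)) : \bar R :=
  (\int[lebesgue_vec d]_(x in A) (heat_kernel 1 x)%:E)%E.

Let std_gaussian0 : std_gaussian set0 = 0%E.
Proof. by rewrite /std_gaussian integral_set0. Qed.

Let std_gaussian_ge0 A : (0 <= std_gaussian A)%E.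
Proof. by apply: integral_ge0 => x _; rewrite lee_fin heat_kernel_ge0. Qed.

Let std_gaussian_sigma_additive : semi_sigma_additive std_gaussian.
Proof.
move=> F mF tF mUF; rewrite /std_gaussian ge0_integral_bigcup//; last 2 first.
- apply/measurable_EFinP/measurable_funTS; exact: measurable_heat_kernel.
- by move=> x _; rewrite lee_fin heat_kernel_ge0.
apply: is_cvg_ereal_nneg_natsum_cond => n _ _.
by apply: integral_ge0 => x _; rewrite lee_fin heat_kernel_ge0.
Qed.

HB.instance Definition _ := isMeasure.Build _ _ _ std_gaussian
  std_gaussian0 std_gaussian_ge0 std_gaussian_sigma_additive.

End euclidean_space.

Section multi_index.
Context {d : nat}.
Implicit Types a : d.-tuple nat.

Definition multi_index (j : nat) : set (d.-tuple nat) :=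
  [set a | (\sum_(i < d) tnth a i)%N = j].

Definition multi_fact a : nat := (\prod_(i < d) (tnth a i)`!)%N.

Definition monomial {R : realType} a (y : Rvec R d) : R :=
  \prod_(i < d) vcoord i y ^+ tnth a i.

(* Finiteness makes the sums [\sum_(a \in multi_index j) _] genuine. *)
Lemma finite_multi_index j : finite_set (multi_index j).
Proof.
pose g (b : d.-tuple 'I_j.+1) : d.-tuple nat := map_tuple val b.
apply: (@sub_finite_set _ _ (g @` setT)); last first.
  exact/finite_image/finite_finset.
move=> a /= aj; exists [tuple inord (tnth a i) | i < d] => //.
apply: eq_from_tnth => i; rewrite tnth_map tnth_mktuple /= inordK// ltnS -aj.
by rewrite (bigD1 i)//= leq_addr.
Qed.

End multi_index.

Section hermite.
Context {R : realType}.

Definition hermite (m : nat) (x : R) : R :=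
  (-1) ^+ m * expR (x ^+ 2 / 2) *
  derive1n m (fun y : R => expR (- (y ^+ 2 / 2))) x.

Definition multi_hermite d (a : d.-tuple nat) (x : Rvec R d) : R :=
  \prod_(i < d) hermite (tnth a i) (vcoord i x).

End hermite.

Section random_vectors.
Context {R : realType} {d : nat}.

(* Laws are compared on measurable sets only, since the values of a measure
   elsewhere are meaningless. *)
Definition has_law dT (T : measurableType dT) (P : probability T R)
    (X : {RV P >-> Rvec R d}) (mu : probability (Rvec R d) R) : Prop :=
  forall A, measurable A -> distribution P X A = mu A.

Definition finite_moment (mu : probability (Rvec R d) R) (k : nat) : Prop :=
  (\int[mu]_x (enorm x ^+ k)%:E < +oo)%E.

Definition moment dT (T : measurableType dT) (P : probability T R)
    (X : {RV P >-> Rvec R d}) (a : d.-tuple nat) : \bar R :=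
  ('E_P[fun w => monomial a (X w)])%E.

(* n is the largest order up to which all mixed moments of X and Y agree. X and
   Y may live on different probability spaces. Moments are extended reals
   here; those used are finite when the moments of order n+1 exist. *)
Definition condition_M dX (TX : measurableType dX)
    (PX : probability TX R) (X : {RV PX >-> Rvec R d})
    dY (TY : measurableType dY) (PY : probability TY R)
    (Y : {RV PY >-> Rvec R d}) (n : nat) : Prop :=
  (forall k a, (k <= n)%N -> multi_index k a -> moment X a = moment Y a) /\
  (exists2 a, multi_index n.+1 a & moment X a <> moment Y a).

End random_vectors.

(* Main.v *)
Require Import Defs.
From HB Require Import structures.
From mathcomp Require Import all_boot all_order all_algebra.
From mathcomp Require Import finmap.
From mathcomp Require Import all_classical all_reals all_analysis.
From mathcomp Require Import measurable_realfun ring lra.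

(* With s = t^(-1/2), rescaling space by s turns t^((n+1)/2) d_TV into
   1/2 s^-(n+1) times the L1 norm over z of the integral of rho_1(z - s y)
   against mu - nu. Expand y |-> rho_1(z - s y) at 0: the term of order j is
   s^j times the sum over [j] of y^a / a! H_a(z) rho_1(z), so the orders up to n
   cancel, order n+1 gives the limit, and it remains to see that the remainder
   of order n+2 has L1 norm in z at most C |s y|^(n+2), since its integral
   against mu + nu, divided by s^(n+1), is then O(s).
   That bound holds in dimension 1 by the mean value theorem when |u| <= 1 and
   because each term of the expansion is bounded in L1 by a power of |u| when
   |u| > 1. It passes to dimension d by induction, since the Taylor remainder of
   a product splits as
   R_m(a, w) G + sum_(k < m) a^k / k! g_k(w) R'_(m-k)(y, z). *)

Set Implicit Arguments.
Unset Strict Implicit.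
Unset Printing Implicit Defensive.

Import Order.TTheory GRing.Theory Num.Theory.
Import numFieldNormedType.Exports.

Local Open Scope classical_set_scope.
Local Open Scope ring_scope.

(** * Derivatives of the one-dimensional Gaussian density and their Taylor remainders *)

Section hermite_functions.
Context {R : realType}.
Implicit Types (x z u v : R) (k m : nat) (p : {poly R}).

(** Differentiating [p(x) exp(-x^2/2)] gives [-(x p - p') exp(-x^2/2)], whence the recursion;
    [hermiteE] identifies these with the Hermite polynomials. *)
Fixpoint hermite_poly k : {poly R} :=
  if k is k'.+1 then 'X * hermite_poly k' - (hermite_poly k')^`() else 1.

(* (-1)^k times the k-th derivative of the standard Gaussian density. *)
Definition hgauss k x : R := (hermite_poly k).[x] * normal_pdf 0 1 x.

Lemma normal_pdf01E x :
  normal_pdf 0 1 x = normal_peak 1 * expR (- (x ^+ 2 / 2)).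
Proof.
rewrite normal_pdfE ?oner_eq0// /normal_fun subr0 expr1n.
by rewrite mulNr.
Qed.

Lemma is_derive_exp_sqr x :
  is_derive x 1 (fun y : R => expR (- (y ^+ 2 / 2)))
    (- x * expR (- (x ^+ 2 / 2))).
Proof.
apply: is_derive_eq.
rewrite /GRing.scale/=; set e := expR _.
lra.
Qed.

Lemma derive1n_gauss k :
  derive1n k (fun y : R => expR (- (y ^+ 2 / 2))) =
  (fun y => (-1) ^+ k * (hermite_poly k).[y] * expR (- (y ^+ 2 / 2))).
Proof.
elim: k => [|k IH].
  by rewrite derive1n0; apply/funext => y; rewrite expr0 hornerC !mul1r.
rewrite derive1nS IH; apply/funext => y; rewrite derive1E /=.
have e1 := is_derive_exp_sqr y.
(* The sign is absorbed into the polynomial, so that the product rule for a polynomial times the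
   Gaussian applies. *)
have e2 := is_derive_poly (((-1) ^+ k)%:P * hermite_poly k) y.
rewrite (_ : (fun y0 : R => _) = horner (((-1) ^+ k)%:P * hermite_poly k) *
   (fun y : R => expR (- (y ^+ 2 / 2)))); last first.
  by apply/funext => z; rewrite !fctE !hornerE.
rewrite derive_val derivM derivC [_ ^+ k.+1]exprS /GRing.scale/=.
by rewrite !(hornerM, hornerC, hornerD, hornerN, hornerX); ring.
Qed.

Lemma hermiteE k x : hermite k x = (hermite_poly k).[x].
Proof.
rewrite /hermite derive1n_gauss mulrACA -expRD subrr expR0 mulr1 mulrA.
by rewrite -exprD addnn -mul2n exprM sqrrN expr1n expr1n mul1r.
Qed.

Lemma is_derive_hgauss k x : is_derive x 1 (hgauss k) (- hgauss k.+1 x).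
Proof.
have e1 := is_derive_exp_sqr x.
have e2 := is_derive_poly (hermite_poly k) x.
rewrite (_ : hgauss k =
   normal_peak 1 \*: (horner (hermite_poly k) *
   (fun y : R => expR (- (y ^+ 2 / 2))))); last first.
  by apply/funext => y; rewrite /hgauss normal_pdf01E mulrCA.
apply: is_derive_eq.
rewrite /hgauss normal_pdf01E /GRing.scale/=.
by rewrite !(hornerM, hornerD, hornerN, hornerX); ring.
Qed.

(** [x^n / n!] is one term of the exponential series. *)
Lemma exprn_le_expR n x : 0 <= x -> x ^+ n <= n`!%:R * expR x.
Proof.
case: n => [x0|n x0]; first by rewrite expr0 fact0 mul1r -expR0 ler_expR.
rewrite mulrC -ler_pdivrMr ?ltr0n ?fact_gt0//.
by apply: le_trans (expR_ge1Dxn n x0); rewrite lerDr.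
Qed.

Lemma normr_horner_le p : exists2 C : R, 0 <= C & forall x,
  `|p.[x]| <= C * expR `|x|.
Proof.
exists (\sum_(i < size p) `|p`_i| * (i`!)%:R).
  by apply: sumr_ge0 => i _; rewrite mulr_ge0.
move=> x; rewrite horner_coef (le_trans (ler_norm_sum _ _ _))// mulr_suml.
apply: ler_sum => i _; rewrite normrM normrX -mulrA ler_wpM2l//.
exact: exprn_le_expR.
Qed.

(* The wider Gaussian absorbs the polynomial factor and the unit shift; any
   standard deviation above 1 would do. *)
Lemma hgauss_le k : exists2 C : R, 0 <= C & forall x v, `|v| <= 1 ->
  `|hgauss k (x - v)| <= C * normal_pdf 0 2 x.
Proof.
have [C C0 HC] := normr_horner_le (hermite_poly k).
have p20 : (2 : R) != 0 by rewrite pnatr_eq0.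
have np2 : 0 < normal_peak (2 : R) by exact: normal_peak_gt0.
exists (C * expR (5 / 4) * normal_peak 1 / normal_peak 2).
  by rewrite !mulr_ge0 ?expR_ge0 ?normal_peak_ge0// invr_ge0 normal_peak_ge0.
move=> x v v1.
rewrite /hgauss normrM (ger0_norm (normal_pdf_ge0 _ _ _)).
rewrite normal_pdf01E [normal_pdf 0 2]normal_pdfE// /normal_fun subr0.
rewrite [leRHS]mulrA divfK ?gt_eqF// mulrCA.
rewrite [leRHS](_ : _ = normal_peak 1 *
  (C * (expR (5 / 4) * expR (- x ^+ 2 / (2 ^+ 2 *+ 2))))); last by ring.
rewrite ler_wpM2l ?normal_peak_ge0//.
apply: (@le_trans _ _ (C * expR `|x - v| * expR (- ((x - v) ^+ 2 / 2)))).
  by rewrite ler_wpM2r ?expR_ge0.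
rewrite -mulrA ler_wpM2l// -!expRD ler_expR.
have : `|x - v| ^+ 2 = (x - v) ^+ 2 by rewrite real_normK// num_real.
have : v ^+ 2 <= 1 by rewrite -real_normK ?num_real// expr_le1.
set w := `|x - v|; move=> h1 h2.
(* The squares give [w <= w^2/4 + 1] and [x^2/8 <= w^2/4 + v^2/4]. Since [v^2 <= 1], it follows that
   [w - w^2/2 <= 5/4 - x^2/8], which is where [5/4] comes from. *)
have := sqr_ge0 (w - 2); have := sqr_ge0 (x - 2 * v).
rewrite (_ : 2 ^+ 2 *+ 2 = 8 :> R); last by ring.
nra.
Qed.

(** Taylor remainder at [u = 0] of [u |-> hgauss k (z - u)], the terms of degree below [m] being
    removed. No sign occurs: the one in the derivative of [hgauss] cancels the one of [-u]. *)
Definition hgauss_rem m k u z :=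
  hgauss k (z - u) - \sum_(j < m) u ^+ j / j`!%:R * hgauss (k + j) z.

Lemma hgauss_rem_at0 m k z : hgauss_rem m.+1 k 0 z = 0.
Proof.
rewrite /hgauss_rem subr0 big_ord_recl big1 => [|i _].
  by rewrite expr0 fact0 divr1 mul1r addn0 addr0 subrr.
by rewrite /= /bump/= add1n exprS mul0r mul0r mul0r.
Qed.

(** A derivative in [u] lowers the order of the remainder by one and raises the index of [hgauss] by
    one, which drives the induction in [hgauss_rem_le]. *)
Lemma is_derive_hgauss_rem m k z u :
  is_derive u 1 (fun w => hgauss_rem m.+1 k w z) (hgauss_rem m k.+1 u z).
Proof.
have e1 : is_derive u 1 (fun w : R => hgauss k (z - w)) (hgauss k.+1 (z - u)).
  have e := is_derive_hgauss k (z - u).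
  have e2 : is_derive u 1 (fun w : R => z - w) (-1).
    by apply: is_derive_eq; lra.
  apply: is_derive_eq.
  by rewrite /GRing.scale/=; ring.
have e2 : is_derive u 1 (\sum_(j < m.+1)
   (fun w : R => w ^+ j / j`!%:R * hgauss (k + j) z))
   (\sum_(j < m.+1) (j%:R * u ^+ j.-1 / j`!%:R * hgauss (k + j) z)).
  apply: is_derive_sum => j.
  rewrite (_ : (fun w => _) =
      horner ((hgauss (k + j) z / j`!%:R)%:P * 'X^j)); last first.
    by apply/funext => w; rewrite hornerM hornerC hornerXn mulrC mulrA mulrAC.
  apply: is_derive_eq.
  rewrite derivM derivC mul0r add0r derivXn hornerM hornerC hornerMn hornerXn.
  by rewrite mulrC -mulr_natl mulrA mulrAC -mulrA.
rewrite (_ : (fun w => _) = (fun w : R => hgauss k (z - w)) - \sum_(j < m.+1)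
   (fun w : R => w ^+ j / j`!%:R * hgauss (k + j) z)); last first.
  by apply/funext => w; rewrite /hgauss_rem !fctE fct_sumE.
apply: is_derive_eq.
rewrite /hgauss_rem big_ord_recl !mul0r add0r; congr (_ - _).
apply: eq_bigr => j _; rewrite /= /bump/= add1n addnS factS natrM addSn.
congr (_ * _); field.
by rewrite nat1r !pnatr_eq0 -lt0n fact_gt0.
Qed.

(** Induction on [m], for all [k]: the remainder vanishes at [u = 0], so the mean value theorem
    yields a factor [u] and a remainder of lower order at an intermediate point. *)
Lemma hgauss_rem_le m k : exists2 C : R, 0 <= C & forall u z, `|u| <= 1 ->
  `|hgauss_rem m k u z| <= C * normal_pdf 0 2 z * `|u| ^+ m.
Proof.
elim: m k => [|m IH] k.
  have [C C0 HC] := hgauss_le k; exists C => // u z u1.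
  by rewrite /hgauss_rem big_ord0 subr0 expr0 mulr1; exact: HC.
have [C C0 HC] := IH k.+1; exists C => // u z u1.
have dh v : is_derive v 1 (fun w => hgauss_rem m.+1 k w z) (hgauss_rem m k.+1 v z).
  exact: is_derive_hgauss_rem.
have ch (a b : R) : {within `[a, b], continuous (fun w => hgauss_rem m.+1 k w z)}.
  apply: derivable_within_continuous => x _.
  by case: (dh x).
(* The mean value theorem works on an ordered segment, hence the two cases for the sign of [u]. *)
have [c cu hc] : exists2 c, `|c| <= `|u| &
    hgauss_rem m.+1 k u z = hgauss_rem m k.+1 c z * u.
  have [u0|u0] := leP 0 u.
    have [c] := MVT_segment u0 (fun v _ => dh v) (ch _ _).
    rewrite hgauss_rem_at0 !subr0 in_itv/= => /andP[c0 cu] ->.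
    by exists c => //; rewrite !ger0_norm.
  have [c] := MVT_segment (ltW u0) (fun v _ => dh v) (ch _ _).
  rewrite hgauss_rem_at0 !sub0r in_itv/= => /andP[c0 cu] /eqP.
  rewrite mulrN eqr_opp => /eqP ->.
  by exists c => //; rewrite !ler0_norm ?(ltW u0)// lerN2.
rewrite hc normrM exprSr mulrA ler_wpM2r//.
apply: le_trans (HC _ _ (le_trans cu u1)) _.
rewrite ler_wpM2l ?mulr_ge0 ?normal_pdf_ge0//.
by rewrite lerXn2r ?nnegrE.
Qed.

End hermite_functions.

(** * L1 bounds in dimension one *)

Section one_dimensional_bounds.
Context {R : realType}.
Implicit Types (u : R) (k m : nat).
Local Notation leb := (@lebesgue_measure R).

Lemma continuous_hgauss k : continuous (@hgauss R k).
Proof.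
move=> x; apply/differentiable_continuous/derivable1_diffP.
by case: (is_derive_hgauss k x).
Qed.

Lemma measurable_hgauss k :
  measurable_fun [set: measurableTypeR R] (@hgauss R k).
Proof. by apply: continuous_measurable_fun; exact: continuous_hgauss. Qed.

Lemma measurable_hgauss_shift k u :
  measurable_fun [set: measurableTypeR R] (fun z => @hgauss R k (z - u)).
Proof.
apply: (measurableT_comp (measurable_hgauss k)).
exact: measurable_funB.
Qed.

Lemma measurable_hgauss_rem m k u :
  measurable_fun [set: measurableTypeR R] (hgauss_rem m k u).
Proof.
apply: measurable_funB; first exact: measurable_hgauss_shift.
by apply: measurable_sum => j; apply: measurable_funM => //; exact: measurable_hgauss.
Qed.

Lemma hgauss0_shift u (z : R) : hgauss 0 (z - u) = normal_pdf u 1 z.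
Proof.
rewrite /hgauss hornerC mul1r !normal_pdfE ?oner_eq0//.
by rewrite /normal_fun subr0.
Qed.

Lemma integral_hgauss0_shift u :
  (\int[leb]_z `|hgauss 0 (z - u)|%:E = 1)%E.
Proof.
rewrite -(integral_normal_pdf u 1); apply: eq_integral => z _.
by rewrite hgauss0_shift ger0_norm ?normal_pdf_ge0.
Qed.

Lemma hgauss_L1 k : exists2 C : R, 0 <= C &
  (\int[leb]_z `|hgauss k z|%:E <= C%:E)%E.
Proof.
have [C C0 HC] := @hgauss_le R k; exists C => //.
apply: (@le_trans _ _ (\int[leb]_z (C%:E * (normal_pdf 0 2 z)%:E))%E).
  apply: ge0_le_integral => //.
  - apply/measurable_EFinP/measurableT_comp => //; exact: measurable_hgauss.
  - apply/measurable_EFinP/measurable_funM => //; exact: measurable_normal_pdf.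
  - move=> z _; rewrite -EFinM lee_fin.
    by rewrite -[z in hgauss _ z]subr0 HC// normr0 ler01.
rewrite ge0_integralZl//.
- by rewrite integral_normal_pdf mule1.
- by apply/measurable_EFinP; exact: measurable_normal_pdf.
- by move=> z _; rewrite lee_fin normal_pdf_ge0.
Qed.

Lemma hgauss_rem_L1 m : exists2 C : R, 0 <= C & forall u,
  (\int[leb]_z `|hgauss_rem m 0 u z|%:E <= (C * `|u| ^+ m)%:E)%E.
Proof.
have [C C0 HC] := @hgauss_rem_le R m 0.
(* A bound is chosen for each [k], so that the bounds can be summed in the constant. *)
pose K k := sval (cid2 (hgauss_L1 k)).
have K0 k : 0 <= K k by rewrite /K; case: cid2.
have KL k : (\int[leb]_z `|hgauss k z|%:E <= (K k)%:E)%E by rewrite /K; case: cid2.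
have mh k : measurable_fun [set: measurableTypeR R] (fun z => (`|hgauss k z|%:E)).
  by apply/measurable_EFinP/measurableT_comp => //; exact: measurable_hgauss.
have mr u : measurable_fun [set: measurableTypeR R]
    (fun z => (`|hgauss_rem m 0 u z|%:E)).
  by apply/measurable_EFinP/measurableT_comp => //; exact: measurable_hgauss_rem.
have S0 : 0 <= \sum_(j < m) K j by exact: sumr_ge0.
(* [C] serves [|u| <= 1]. For [|u| > 1], the [1] is the mass of the shifted density and [K j] bounds
   the term of degree [j]. *)
exists (C + (1 + \sum_(j < m) K j)) => [|u].
  by rewrite !addr_ge0.
have [u1|u1] := leP `|u| 1.
  apply: (@le_trans _ _
      (\int[leb]_z ((C * `|u| ^+ m)%:E * (normal_pdf 0 2 z)%:E))%E).
    apply: ge0_le_integral => //.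
    - apply/measurable_EFinP/measurable_funM => //; exact: measurable_normal_pdf.
    - by move=> z _; rewrite -EFinM lee_fin mulrAC HC.
  rewrite ge0_integralZl//; last 3 first.
  - by apply/measurable_EFinP; exact: measurable_normal_pdf.
  - by move=> z _; rewrite lee_fin normal_pdf_ge0.
  - by rewrite lee_fin mulr_ge0.
  rewrite integral_normal_pdf mule1 lee_fin ler_wpM2r// lerDl.
  by rewrite addr_ge0.
(* For [|u| > 1] the triangle inequality suffices, since [1] and every [|u|^j] with [j < m] are at
   most [|u|^m]. *)
apply: (@le_trans _ _ (\int[leb]_z (`|hgauss 0 (z - u)|%:E +
    \sum_(j < m) (`|u| ^+ j / j`!%:R)%:E * `|hgauss j z|%:E))%E).
  apply: ge0_le_integral => //.
  - apply: emeasurable_funD.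
      apply/measurable_EFinP/measurableT_comp => //.
      exact: measurable_hgauss_shift.
    by apply: emeasurable_sum => j; exact: measurable_funeM.
  - move=> z _; under eq_bigr do rewrite -EFinM.
    rewrite sumEFin -EFinD lee_fin (le_trans (ler_normB _ _))// lerD2l.
    rewrite (le_trans (ler_norm_sum _ _ _))//; apply: ler_sum => j _.
    by rewrite !normrM normfV normr_nat normrX.
rewrite ge0_integralD//; last 3 first.
- apply/measurable_EFinP/measurableT_comp => //.
  exact: measurable_hgauss_shift.
- move=> z _; apply: sume_ge0 => j _.
  by rewrite -EFinM lee_fin mulr_ge0// divr_ge0.
- by apply: emeasurable_sum => j; exact: measurable_funeM.
rewrite integral_hgauss0_shift ge0_integral_sum//; last first.
  by move=> j; exact: measurable_funeM.
apply: (@le_trans _ _ ((1 + \sum_(j < m) K j) * `|u| ^+ m)%:E); last first.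
  by rewrite lee_fin ler_wpM2r// lerDr.
rewrite mulrDl mul1r mulr_suml EFinD -sumEFin leeD//.
  by rewrite lee_fin exprn_ege1// ltW.
apply: lee_sum => j _.
rewrite ge0_integralZl//.
apply: (@le_trans _ _ ((`|u| ^+ j / j`!%:R)%:E * (K j)%:E)%E).
  by rewrite lee_wpmul2l// lee_fin divr_ge0.
rewrite -EFinM lee_fin mulrC ler_wpM2l//.
rewrite ler_pdivrMr ?ltr0n ?fact_gt0// (@le_trans _ _ (`|u| ^+ m))//.
  by rewrite ler_weXn2l ?(ltW u1)// ltnW.
by rewrite ler_peMr// ler1n fact_gt0.
Qed.

End one_dimensional_bounds.

(** * Multi-indices split along the first coordinate *)

Section multi_index_recursion.
Implicit Types j k d : nat.

(** A permutation is enough for sums, and the order in which [fset_set] lists its elements is not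
    controlled. The subtraction [j - k] is genuine because [k <= j]. *)
Lemma perm_multi_index d j :
  perm_eq (fset_set (@multi_index d.+1 j))
    [seq [tuple of k :: b] | k : nat <- iota 0 j.+1,
                            b : d.-tuple nat <- fset_set (@multi_index d (j - k))].
Proof.
apply: uniq_perm; first exact: fset_uniq.
  apply: allpairs_uniq_dep; first exact: iota_uniq.
    by move=> k _; exact: fset_uniq.
  move=> [k b] [k' b'] _ _ /= /(congr1 val)/= [-> bb'].
  by congr existT; exact: val_inj.
move=> a; apply/idP/allpairsPdep => [|[k [b [+ + ->]]]].
  rewrite in_fset_set; last exact: finite_multi_index.
  rewrite inE /multi_index /= big_ord_recl => aj.
  exists (tnth a ord0), [tuple of behead a]; split.
  - by rewrite -[_ :: _]/(iota 0 j.+1) mem_iota /= ltnS -aj leq_addr.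
  - rewrite in_fset_set; last exact: finite_multi_index.
    rewrite inE /multi_index/= -aj addKn; apply: eq_bigr => i _.
    by rewrite [in RHS](tuple_eta a) tnthS.
  - by rewrite [LHS]tuple_eta; exact: val_inj.
rewrite mem_iota /= add0n ltnS => kj.
rewrite !in_fset_set; [|exact: finite_multi_index..].
rewrite !inE /multi_index/= => bj.
rewrite big_ord_recl tnth0; under eq_bigr do rewrite tnthS.
by rewrite bj subnKC.
Qed.

Lemma big_multi_indexS (R : nmodType) d j (F : d.+1.-tuple nat -> R) :
  \sum_(a <- fset_set (@multi_index d.+1 j)) F a =
  \sum_(k < j.+1) \sum_(b <- fset_set (@multi_index d (j - k)))
    F [tuple of (k : nat) :: (b : d.-tuple nat)].
Proof.
rewrite (perm_big _ (perm_multi_index d j)) big_allpairs_dep.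
by rewrite -[iota 0 j.+1]/(index_iota 0 j.+1) big_mkord.
Qed.

End multi_index_recursion.

(** * Taylor expansion of the Gaussian density in several variables *)

Section taylor_terms.
Context {R : realType}.
Implicit Types (d j m : nat).

(** The part of degree [j] in [y] of the Taylor expansion at [y = 0] of the standard Gaussian
    density at [z - y]. *)
Definition taylor_term d j (y z : Rvec R d) : R :=
  \sum_(a <- fset_set (@multi_index d j))
    (multi_fact a)%:R^-1 * monomial a y *
    \prod_(i < d) hgauss (tnth a i) (vcoord i z).

(** For [m = 0] this is the Gaussian density at [z - y] itself, and it stands for that density
    below. *)
Definition taylor_rem d m (y z : Rvec R d) : R :=
  \prod_(i < d) hgauss 0 (vcoord i z - vcoord i y) -
  \sum_(j < m) taylor_term j y z.

Lemma vcoord0 d (a : R) (y : Rvec R d) : vcoord ord0 (vcons (a, y)) = a.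
Proof. by rewrite /vcoord tnth0. Qed.

Lemma vcoordS d (a : R) (y : Rvec R d) i :
  vcoord (lift ord0 i) (vcons (a, y)) = vcoord i y.
Proof. by rewrite /vcoord tnthS. Qed.

Lemma taylor_term_cons d j (a w : R) (y z : Rvec R d) :
  taylor_term j (vcons (a, y)) (vcons (w, z)) =
  \sum_(k < j.+1) a ^+ k / k`!%:R * hgauss k w * taylor_term (j - k) y z.
Proof.
rewrite /taylor_term big_multi_indexS; apply: eq_bigr => k _.
rewrite mulr_sumr; apply: eq_bigr => b _.
rewrite /multi_fact /monomial !big_ord_recl !tnth0 !vcoord0.
under eq_bigr do rewrite tnthS.
under [X in _ * (_ * X) * _]eq_bigr do rewrite tnthS vcoordS.
under [X in _ * (_ * _) * (_ * X)]eq_bigr do rewrite tnthS vcoordS.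
by rewrite natrM invfM; ring.
Qed.

(** The factor [hgauss 0 (w - a)] is its remainder plus its terms of degree [k < m]; next to the
    term of degree [k], the other factor is expanded only below degree [m - k]. This removes exactly
    the terms of total degree below [m]. *)
Lemma taylor_rem_cons d m (a w : R) (y z : Rvec R d) :
  taylor_rem m (vcons (a, y)) (vcons (w, z)) =
  hgauss_rem m 0 a w * taylor_rem 0 y z +
  \sum_(k < m) a ^+ k / k`!%:R * hgauss k w * taylor_rem (m - k) y z.
Proof.
rewrite /taylor_rem big_ord_recl !vcoord0.
under eq_bigr do rewrite !vcoordS.
set G := \prod_(i < d) _; rewrite big_ord0 subr0.
under eq_bigr do rewrite taylor_term_cons.
under [X in _ = _ + X]eq_bigr do rewrite mulrBr.
have -> : hgauss_rem m 0 a w = hgauss 0 (w - a) -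
   \sum_(k < m) a ^+ k / k`!%:R * hgauss k w by [].
rewrite sumrB mulrBl mulr_suml [RHS]addrA subrK; congr (_ - _).
(* Both sides sum [F k i] over [k + i < m], grouped by [j = k + i] on the left and by [k] on the
   right. *)
pose F k i := a ^+ k / k`!%:R * hgauss k w * taylor_term i y z.
transitivity (\sum_(0 <= j < m) \sum_(0 <= k < m | (k < j.+1)%N) F k (j - k)%N).
  rewrite big_mkord; apply: eq_bigr => j _.
  by rewrite -(@big_nat_widen _ _ _ 0 j.+1 m xpredT)// big_mkord.
rewrite (@exchange_big_dep_nat _ _ _ _ _ _ _ _ _ xpredT)//= big_mkord.
apply: eq_bigr => k _.
rewrite mulr_sumr -(big_mkord xpredT (F k)).
transitivity (\sum_(0 <= i < m - k) F k (i + k - k)%N); last first.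
  by apply: eq_bigr => i _; rewrite addnK.
rewrite -(big_addn 0 m k xpredT (fun j => F k (j - k)%N)) add0n.
by rewrite (@big_nat_widenl _ _ _ k 0).
Qed.

End taylor_terms.

(** * Tonelli and scaling for Lebesgue measure in d dimensions *)

Section lebesgue_vec_integral.
Local Open Scope ereal_scope.
Context {R : realType}.
Implicit Types (d : nat) (s : R).
Local Notation leb := (@lebesgue_measure R).

Lemma ge0_integral_vec0 (f : Rvec R 0 -> \bar R) :
  measurable_fun setT f -> \int[lebesgue_vec 0]_x f x = f [tuple].
Proof. by move=> mf; rewrite integral_dirac// diracT mul1e. Qed.

Lemma ge0_integral_vecS d (f : Rvec R d.+1 -> \bar R) :
  measurable_fun setT f -> (forall x, 0 <= f x) ->
  \int[lebesgue_vec d.+1]_x f x =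
  \int[leb]_w \int[lebesgue_vec d]_z f (vcons (w, z)).
Proof.
move=> mf f0.
rewrite (ge0_integral_pushforward (@measurable_vcons _ _ d))//.
rewrite preimage_setT.
rewrite (fubini_tonelli1 (f \o @vcons _ _ d))//; last by move=> x; exact: f0.
apply: measurableT_comp => //; exact: measurable_vcons.
Qed.

Lemma ge0_integral_vecM d (p : R -> \bar R) (q : Rvec R d -> \bar R) :
  measurable_fun [set: measurableTypeR R] p -> measurable_fun setT q ->
  (forall x, 0 <= p x) -> (forall x, 0 <= q x) ->
  \int[lebesgue_vec d.+1]_x (p (vuncons x).1 * q (vuncons x).2) =
  \int[leb]_w p w * \int[lebesgue_vec d]_z q z.
Proof.
move=> mp mq p0 q0; rewrite ge0_integral_vecS; last 2 first.
- apply: emeasurable_funM.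
    apply: (measurableT_comp mp).
    by apply: measurableT_comp; [exact: measurable_fst|exact: measurable_vuncons].
  apply: (measurableT_comp mq).
  by apply: measurableT_comp; [exact: measurable_snd|exact: measurable_vuncons].
- by move=> x; exact: mule_ge0.
under eq_integral do under eq_integral do rewrite vconsK/=.
under eq_integral do rewrite ge0_integralZl//.
by rewrite ge0_integralZr//; exact: integral_ge0.
Qed.

(** By uniqueness of Lebesgue measure: [s] times its image under multiplication by [s] gives []a,
    b]] the mass [s (b/s - a/s) = b - a]. *)
Lemma ge0_integral_scale s (f : R -> \bar R) : (0 < s)%R ->
  measurable_fun [set: measurableTypeR R] f -> (forall x, 0 <= f x) ->
  \int[leb]_x f x = s%:E * \int[leb]_x f (s * x)%R.
Proof.
move=> s0 mf f0.
have ms : measurable_fun [set: measurableTypeR R]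
    ( *%R s : measurableTypeR R -> measurableTypeR R).
  exact: measurable_funM.
pose mphi := isMeasurableFun.Build _ _ _ _ _ ms.
pose phi : {mfun _ >-> _} :=
  HB.pack ( *%R s : measurableTypeR R -> measurableTypeR R) mphi.
pose sp := NngNum (ltW s0).
have E A : measurable A -> leb A = mscale sp (pushforward leb phi) A.
  apply: lebesgue_measure_unique => //= _ [[a b]] _ <-.
  rewrite /mscale/= /pushforward.
  rewrite (_ : _ @^-1` _ = `](a / s)%R, (b / s)%R]%classic); last first.
    apply/seteqP; split => x /=; rewrite !in_itv/=.
      by rewrite ltr_pdivrMr// ler_pdivlMr// ![(x * s)%R]mulrC.
    by rewrite ltr_pdivrMr// ler_pdivlMr// ![(x * s)%R]mulrC.
  rewrite !lebesgue_measure_itv/= !lte_fin ltr_pM2r ?invr_gt0//.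
  case: ifP => _; last by rewrite mule0.
  by rewrite -!EFinD -EFinM -mulrBl mulrCA divff ?gt_eqF// mulr1.
rewrite (eq_measure_integral (mscale sp (pushforward leb phi)))//; last first.
  by move=> A mA _; exact: E.
rewrite ge0_integral_mscale// ge0_integral_pushforward//.
Qed.

Definition scalev d s (x : Rvec R d) : Rvec R d :=
  [tuple (s * vcoord i x)%R | i < d].

Lemma vcoord_scalev d s (x : Rvec R d) i :
  vcoord i (scalev s x) = (s * vcoord i x)%R.
Proof. by rewrite /vcoord tnth_mktuple. Qed.

Lemma scalev_cons d s (a : R) (x : Rvec R d) :
  scalev s (vcons (a, x)) = vcons ((s * a)%R, scalev s x).
Proof.
apply: eq_from_tnth => i; rewrite -/(vcoord i _) vcoord_scalev.
case: (unliftP ord0 i) => [j ->|->].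
  by rewrite vcoordS -/(vcoord _ _) vcoordS vcoord_scalev.
by rewrite vcoord0 -/(vcoord _ _) vcoord0.
Qed.

Lemma measurable_tuple_ffun d dT (T : measurableType dT) (f : 'I_d -> T -> R) :
  (forall i, measurable_fun setT (f i)) ->
  measurable_fun setT (fun x => [tuple f i x | i < d] : Rvec R d).
Proof.
move=> mf; apply/measurable_fun_tnthP => i.
rewrite (_ : _ \o _ = f i); first exact: mf.
by apply/funext => x /=; rewrite tnth_mktuple.
Qed.

Lemma measurable_scalev d s : measurable_fun setT (@scalev d s).
Proof.
apply: measurable_tuple_ffun => i; apply: measurable_funM => //.
exact: measurable_vcoord.
Qed.

Lemma ge0_integral_scale_vec d s (f : Rvec R d -> \bar R) : (0 < s)%R ->
  measurable_fun setT f -> (forall x, 0 <= f x) ->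
  \int[lebesgue_vec d]_x f x =
  (s ^+ d)%:E * \int[lebesgue_vec d]_x f (scalev s x).
Proof.
move=> s0; elim: d f => [|d IH] f mf f0.
  rewrite !ge0_integral_vec0//; first by rewrite expr0 mul1e [scalev _ _]tuple0.
  by apply: measurableT_comp => //; exact: measurable_scalev.
have mfs : measurable_fun setT (fun x => f (scalev s x)).
  by apply: measurableT_comp => //; exact: measurable_scalev.
have mfc w : measurable_fun setT (fun z => f (vcons (w, z))).
  apply: measurableT_comp => //; apply: measurableT_comp => //.
  exact: measurable_vcons.
have mfm : measurable_fun [set: measurableTypeR R]
    (fun w => \int[lebesgue_vec d]_z f (vcons (w, z))).
  apply: (measurable_fun_fubini_tonelli_F (fun p => f (vcons p))) => //.
  by apply: measurableT_comp => //; exact: measurable_vcons.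
rewrite [LHS]ge0_integral_vecS// (ge0_integral_scale s0)//; last first.
  by move=> w; exact: integral_ge0.
under eq_integral do rewrite IH//.
rewrite ge0_integralZl//; last 3 first.
(* Measurability in [w] comes from Tonelli, once the two scalings are joined into one scaling of the
   vector [(w, z)]. *)
- pose g p := f (scalev s (vcons p)).
  rewrite (_ : (fun w => _) =
      fun w => \int[lebesgue_vec d]_z g (w, z)); last first.
    by apply/funext => w; apply: eq_integral => z _; rewrite /g scalev_cons.
  apply: (measurable_fun_fubini_tonelli_F g); last by move=> p; exact: f0.
  by apply: (measurableT_comp mfs); exact: measurable_vcons.
- by move=> w _; exact: integral_ge0.
- by rewrite lee_fin exprn_ge0// ltW.
rewrite muleA -EFinM -exprS; congr *%E.
rewrite ge0_integral_vecS//.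
by under [RHS]eq_integral do under eq_integral do rewrite scalev_cons.
Qed.

End lebesgue_vec_integral.

(** * L1 bound for the Taylor remainder in several variables *)

Section taylor_remainder.
Context {R : realType}.
Implicit Types (d m : nat).
Local Notation leb := (@lebesgue_measure R).

Lemma normr_vcoord_le d (x : Rvec R d) i : `|vcoord i x| <= enorm x.
Proof.
rewrite -sqrtr_sqr ler_wsqrtr// (bigD1 i)//= lerDl.
by apply: sumr_ge0 => j _; exact: sqr_ge0.
Qed.

Lemma enorm_ge0 d (x : Rvec R d) : 0 <= enorm x.
Proof. exact: sqrtr_ge0. Qed.

Lemma enorm_le_vcons d (a : R) (x : Rvec R d) : enorm x <= enorm (vcons (a, x)).
Proof.
rewrite ler_wsqrtr// big_ord_recl -[leLHS]add0r lerD ?sqr_ge0//.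
by apply: ler_sum => i _; rewrite vcoordS.
Qed.

Lemma measurable_prod_hgauss d (a : d.-tuple nat) : measurable_fun setT
  (fun z : Rvec R d => \prod_(i < d) hgauss (tnth a i) (vcoord i z)).
Proof.
apply: measurable_prod => i _; apply: (measurableT_comp (measurable_hgauss _)).
exact: measurable_vcoord.
Qed.

Lemma measurable_monomial d (a : d.-tuple nat) :
  measurable_fun setT (@monomial d R a).
Proof.
apply: measurable_prod => i _; apply: measurable_funX.
exact: measurable_vcoord.
Qed.

Lemma measurable_taylor_term d m : measurable_fun setT
  (fun p : Rvec R d * Rvec R d => taylor_term m p.1 p.2).
Proof.
apply: measurable_sum => a; apply: measurable_funM.
  apply: measurable_funM => //.
  exact: measurableT_comp (measurable_monomial a) measurable_fst.
exact: measurableT_comp (measurable_prod_hgauss a) measurable_snd.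
Qed.

Lemma measurable_taylor_rem d m : measurable_fun setT
  (fun p : Rvec R d * Rvec R d => taylor_rem m p.1 p.2).
Proof.
apply: measurable_funB; last first.
  by apply: measurable_sum => j; exact: measurable_taylor_term.
apply: measurable_prod => i _; apply: (measurableT_comp (measurable_hgauss _)).
apply: measurable_funB.
  exact: measurableT_comp (measurable_vcoord i) measurable_snd.
exact: measurableT_comp (measurable_vcoord i) measurable_fst.
Qed.

Lemma measurable_taylor_rem2 d m (y : Rvec R d) : measurable_fun setT (taylor_rem m y).
Proof.
exact: (measurable_fun_pair2 y (@measurable_taylor_rem d m)).
Qed.

(** In dimension 0 the norm is 0 and the empty product is 1. For [m = 0] both sides are 1, as
    [0 ^+ 0 = 1]; for [m > 0] the term of degree 0 cancels the product and there are no
    multi-indices of positive order. *)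
Lemma taylor_rem_vec0 m (y z : Rvec R 0) : `|taylor_rem m y z| <= 1 * enorm y ^+ m.
Proof.
have e : enorm y = 0 by rewrite /enorm big_ord0 sqrtr0.
rewrite mul1r e /taylor_rem big_ord0; case: m => [|m].
  by rewrite big_ord0 subr0 expr0 normr1.
rewrite big_ord_recl big1 => [|i _].
  rewrite /taylor_term (_ : multi_index 0 = [set [tuple]]).
    rewrite fset_set1 big_seq_fset1 /multi_fact /monomial !big_ord0.
    by rewrite invr1 !mul1r addr0 subrr normr0 exprn_ge0.
  by apply/seteqP; split => [a _|a _]; rewrite /multi_index/= ?big_ord0// tuple0.
rewrite /taylor_term (_ : multi_index _ = set0) ?fset_set0 ?big_seq_fset0//.
by apply/seteqP; split => // a; rewrite /multi_index/= big_ord0.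
Qed.

(** Induction on [d] by [taylor_rem_cons]: each summand is a function of the first coordinate times
    a function of the others, so its norm factors, and the powers of [|a|] and [|y|] are bounded by
    powers of the norm of [(a, y)]. *)
Lemma taylor_rem_L1 d m : exists2 C : R, 0 <= C & forall y : Rvec R d,
  (\int[lebesgue_vec d]_z `|taylor_rem m y z|%:E <= (C * enorm y ^+ m)%:E)%E.
Proof.
elim: d m => [m|d IH m].
  exists 1 => // y; rewrite ge0_integral_vec0; last first.
    by apply/measurable_EFinP/measurableT_comp => //; exact: measurable_taylor_rem2.
  by rewrite lee_fin taylor_rem_vec0.
pose K k := sval (cid2 (@hgauss_L1 R k)).
have K0 k : 0 <= K k by rewrite /K; case: cid2.
have KL k : (\int[leb]_z `|hgauss k z|%:E <= (K k)%:E)%E by rewrite /K; case: cid2.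
pose D k := sval (cid2 (IH k)).
have D0 k : 0 <= D k by rewrite /D; case: cid2.
have DL k y : (\int[lebesgue_vec d]_z `|taylor_rem k y z|%:E <=
    (D k * enorm y ^+ k)%:E)%E by rewrite /D; case: cid2 => /=.
have [H H0 HL] := @hgauss_rem_L1 R m.
have mt k y : measurable_fun setT (fun z : Rvec R d => `|taylor_rem k y z|%:E).
  by apply/measurable_EFinP/measurableT_comp => //; exact: measurable_taylor_rem2.
have mh k : measurable_fun [set: measurableTypeR R] (fun z => (`|hgauss k z|%:E)).
  by apply/measurable_EFinP/measurableT_comp => //; exact: measurable_hgauss.
have mr u : measurable_fun [set: measurableTypeR R]
    (fun z => (`|hgauss_rem m 0 u z|%:E)).
  by apply/measurable_EFinP/measurableT_comp => //; exact: measurable_hgauss_rem.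
have mfst : measurable_fun setT (fun x : Rvec R d.+1 => (vuncons x).1).
  by apply: measurableT_comp; [exact: measurable_fst|exact: measurable_vuncons].
have msnd : measurable_fun setT (fun x : Rvec R d.+1 => (vuncons x).2).
  by apply: measurableT_comp; [exact: measurable_snd|exact: measurable_vuncons].
(* [D 0] bounds the mass of the Gaussian in the remaining coordinates; [K k * D (m - k)] serves the
   [k]-th summand, where [1/k!] is bounded by 1. *)
exists (H * D 0 + \sum_(k < m) K k * D (m - k)%N) => [|y].
  by rewrite addr_ge0 ?mulr_ge0// sumr_ge0// => k _; rewrite mulr_ge0.
rewrite -(vunconsK y); case: (vuncons y) => a {}y.
set e := enorm (vcons (a, y)).
have e0 : 0 <= e by exact: enorm_ge0.
have ae : `|a| <= e by rewrite -[a in `|a|](vcoord0 a y) normr_vcoord_le.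
have ye : enorm y <= e by exact: enorm_le_vcons.
have yek k : enorm y ^+ k <= e ^+ k by rewrite lerXn2r ?nnegrE ?enorm_ge0.
pose c k := (`|a| ^+ k / k`!%:R)%:E.
have c0 k : (0 <= c k)%E by rewrite lee_fin divr_ge0.
pose f0 (x : Rvec R d.+1) :=
  (`|hgauss_rem m 0 a (vuncons x).1|%:E * `|taylor_rem 0 y (vuncons x).2|%:E)%E.
pose f k (x : Rvec R d.+1) :=
  ((c k * `|hgauss k (vuncons x).1|%:E) * `|taylor_rem (m - k) y (vuncons x).2|%:E)%E.
have mf0 : measurable_fun setT f0.
  apply: emeasurable_funM; first exact: (measurableT_comp (mr a)).
  exact: (measurableT_comp (mt _ y)).
have mf k : measurable_fun setT (f k).
  apply: emeasurable_funM; last exact: (measurableT_comp (mt _ y)).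
  by apply: measurable_funeM; exact: (measurableT_comp (mh k)).
have f00 x : (0 <= f0 x)%E by rewrite mule_ge0.
have fk0 k x : (0 <= f k x)%E by rewrite !mule_ge0.
apply: (@le_trans _ _ (\int[lebesgue_vec d.+1]_x (f0 x + \sum_(k < m) f k x))%E).
  apply: ge0_le_integral => //.
  - by apply/measurable_EFinP/measurableT_comp => //; exact: measurable_taylor_rem2.
  - by apply: emeasurable_funD => //; exact: emeasurable_sum.
  - move=> x _; rewrite -{1}(vunconsK x) /f0 /f; case: (vuncons x) => w z/=.
    rewrite taylor_rem_cons.
    under [X in (_ <= _ + X)%E]eq_bigr do rewrite -!EFinM.
    rewrite sumEFin -EFinM -EFinD lee_fin (le_trans (ler_normD _ _))//.
    rewrite normrM lerD2l (le_trans (ler_norm_sum _ _ _))//.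
    by apply: ler_sum => k _; rewrite !normrM normfV normr_nat normrX.
rewrite ge0_integralD//; last 2 first.
- by move=> x _; exact: sume_ge0.
- exact: emeasurable_sum.
rewrite ge0_integral_sum// mulrDl EFinD leeD//.
  rewrite (ge0_integral_vecM (mr a) (mt 0 y))//.
  apply: (@le_trans _ _ ((H * `|a| ^+ m)%:E * (D 0 * enorm y ^+ 0)%:E)%E).
    by apply: lee_pmul => //; exact: integral_ge0.
  rewrite -EFinM lee_fin expr0 mulr1 mulrAC ler_wpM2l ?mulr_ge0//.
  by rewrite lerXn2r ?nnegrE.
rewrite mulr_suml -sumEFin; apply: lee_sum => k _.
rewrite (ge0_integral_vecM (p := fun w => (c k * `|hgauss k w|%:E)%E)
  _ (mt (m - k)%N y))//; last 2 first.
- exact: measurable_funeM.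
- by move=> x; rewrite mule_ge0.
rewrite ge0_integralZl//.
apply: (@le_trans _ _ ((`|a| ^+ k * K k)%:E *
    (D (m - k)%N * enorm y ^+ (m - k)%N)%:E)%E).
  apply: lee_pmul => //.
  - by rewrite mule_ge0//; exact: integral_ge0.
  - exact: integral_ge0.
  - rewrite EFinM; apply: lee_pmul => //; first exact: integral_ge0.
    by rewrite lee_fin ler_pdivrMr ?ltr0n ?fact_gt0// ler_peMr// ler1n fact_gt0.
have -> : e ^+ m = e ^+ k * e ^+ (m - k) by rewrite -exprD subnKC// ltnW.
rewrite -EFinM lee_fin.
rewrite [leLHS](_ : _ =
  K k * D (m - k)%N * (`|a| ^+ k * enorm y ^+ (m - k))); last by ring.
rewrite ler_wpM2l ?mulr_ge0// ler_pM ?exprn_ge0 ?enorm_ge0//.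
by rewrite lerXn2r ?nnegrE.
Qed.

End taylor_remainder.

(** * Integration against a measure given by a density *)

Section density.
Local Open Scope ereal_scope.
Context dT (T : measurableType dT) (R : realType).
Variables (mu nu : {measure set T -> \bar R}) (w : T -> R).
Hypotheses (mw : measurable_fun setT w) (w0 : forall x, (0 <= w x)%R).
Hypothesis nuE : forall A, measurable A -> nu A = \int[mu]_(x in A) (w x)%:E.

Import HBNNSimple.

(** Simple functions increase to [f], and monotone convergence reduces the claim to them. *)
Lemma ge0_integral_density (f : T -> \bar R) :
  measurable_fun setT f -> (forall x, 0 <= f x) ->
  \int[nu]_x f x = \int[mu]_x (f x * (w x)%:E).
Proof.
move=> mf f0; pose h := nnsfun_approx measurableT mf.
have mW : measurable_fun setT (EFin \o w) by exact/measurable_EFinP.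
have hf x : (EFin \o h n) x @[n --> \oo] --> f x.
  exact: cvg_nnsfun_approx.
have hnd x : {homo (fun n => (h n x)%:E) : a b / (a <= b)%N >-> a <= b}.
  by move=> a b ab; rewrite lee_fin; exact/lefP/nd_nnsfun_approx.
have -> : \int[nu]_x f x = lim (\int[nu]_x (EFin \o h n) x @[n --> \oo]).
  rewrite (eq_integral (fun x => lim ((EFin \o h n) x @[n --> \oo]))); last first.
    by move=> x _; apply/esym/cvg_lim.
  apply: monotone_convergence => //.
  - by move=> n; exact/measurable_EFinP.
  - by move=> n x _; rewrite lee_fin.
  - by move=> x _; exact: hnd.
have -> : \int[mu]_x (f x * (w x)%:E) =
    lim (\int[mu]_x ((EFin \o h n) x * (w x)%:E) @[n --> \oo]).
  have hw x : ((EFin \o h n) x * (w x)%:E) @[n --> \oo] --> f x * (w x)%:E.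
    by apply: cvgeZr.
  rewrite (eq_integral
      (fun x => lim ((EFin \o h n) x * (w x)%:E @[n --> \oo]))); last first.
    by move=> x _; apply/esym/cvg_lim.
  apply: monotone_convergence => //.
  - by move=> n; apply: emeasurable_funM => //; exact/measurable_EFinP.
  - by move=> n x _; rewrite mule_ge0 ?lee_fin.
  - by move=> x _ a b ab; rewrite lee_wpmul2r ?lee_fin// -lee_fin; exact: hnd.
(* For a fixed simple function both integrals are finite sums over its range, and they agree on
   indicators by [nuE]. *)
congr (lim (_ @ \oo)); apply/funext => n /=.
under eq_integral do rewrite fimfunE -fsumEFin//.
rewrite ge0_integral_fsum//; last 2 first.
- by move=> r; apply/measurable_EFinP; exact: measurable_funM.
- by move=> r x _; exact: nnfun_muleindic_ge0.
have E (x : T) : (h n x)%:E * (w x)%:E = \sum_(r \in range (h n))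
    ((r * \1_(h n @^-1` [set r]) x)%:E * (w x)%:E).
  rewrite -ge0_mule_fsuml => [|r]; last exact: nnfun_muleindic_ge0.
  by rewrite fsumEFin// -fimfunE.
under [RHS]eq_integral do rewrite E.
rewrite ge0_integral_fsum//; last 2 first.
- move=> r; apply: emeasurable_funM => //.
  by apply/measurable_EFinP; exact: measurable_funM.
- by move=> r x _; rewrite mule_ge0 ?lee_fin// -lee_fin nnfun_muleindic_ge0.
apply: eq_fsbigr => r; rewrite inE => -[t _ <-].
under eq_integral do rewrite EFinM.
rewrite integralZl_indic_nnsfun//.
under [RHS]eq_integral do rewrite EFinM -muleA.
rewrite ge0_integralZl//; last 3 first.
- by apply: emeasurable_funM => //; exact/measurable_EFinP.
- by move=> x _; rewrite mule_ge0 ?lee_fin.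
- by rewrite lee_fin.
congr *%E; rewrite integral_indic// setIT nuE//.
rewrite integral_mkcond; apply: eq_integral => x _.
by rewrite muleC epatch_indic.
Qed.

End density.

(** * The heat kernel as a rescaled standard Gaussian density *)

Section heat_kernel_scaling.
Context {R : realType}.
Implicit Types (d j m : nat) (s t : R).

Lemma normal_peak1E : normal_peak 1 = (2 * pi) `^ (- 2^-1) :> R.
Proof.
by rewrite /normal_peak expr1n mul1r powRN powR12_sqrt ?mulr_ge0 ?pi_ge0// mulr_natl.
Qed.

Lemma prod_hgauss0 d (x : Rvec R d) : \prod_(i < d) hgauss 0 (vcoord i x) =
  normal_peak 1 ^+ d * expR (- (enorm x ^+ 2 / 2)).
Proof.
under eq_bigr do rewrite /hgauss hornerC mul1r normal_pdf01E.
rewrite big_split/= prodr_const card_ord -expR_sum; congr (_ * expR _).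
rewrite sqr_sqrtr; last by apply: sumr_ge0 => i _; exact: sqr_ge0.
by rewrite sumrN mulr_suml.
Qed.

(** With [s = t^(-1/2)], [s^2 = 1/t] turns [|x|^2 / (2t)] into [|s x|^2 / 2], and [s^d] is the part
    of the normalisation that depends on [t]. *)
Lemma heat_kernelE d t (x : Rvec R d) : 0 < t ->
  heat_kernel t x = (t `^ (- 2^-1)) ^+ d *
    \prod_(i < d) hgauss 0 (t `^ (- 2^-1) * vcoord i x).
Proof.
move=> t0; set s := t `^ _.
under eq_bigr do rewrite -vcoord_scalev.
rewrite prod_hgauss0 mulrA normal_peak1E -exprMn -powRM ?mulr_ge0 ?pi_ge0 ?ltW//.
rewrite -[X in X * _]powR_mulrn ?powR_ge0// -powRrM /heat_kernel [t * _]mulrC.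
congr (_ `^ _ * expR (- _)); first by rewrite mulNr mulrC.
have s2 : s ^+ 2 = t^-1.
  by rewrite -powR_mulrn ?powR_ge0// -powRrM mulNr mulVf// powR_inv1// ltW.
rewrite invfM mulrCA [RHS]mulrC; congr (_ * _).
rewrite !sqr_sqrtr; [|by apply: sumr_ge0 => i _; exact: sqr_ge0..].
rewrite mulr_suml; apply: eq_bigr => i _.
by rewrite vcoord_scalev exprMn s2 mulrC.
Qed.

Lemma heat_kernel_subv d t (x y : Rvec R d) : 0 < t ->
  heat_kernel t (subv x y) = (t `^ (- 2^-1)) ^+ d *
    taylor_rem 0 (scalev (t `^ (- 2^-1)) y) (scalev (t `^ (- 2^-1)) x).
Proof.
move=> t0; rewrite heat_kernelE// /taylor_rem big_ord0 subr0; congr (_ * _).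
apply: eq_bigr => i _; rewrite !vcoord_scalev -mulrBr.
by rewrite {1}/vcoord tnth_mktuple.
Qed.

(** Links the terms of the expansion to the Hermite polynomials and the Gaussian weight of the
    limit. *)
Lemma prod_hgaussE d (a : d.-tuple nat) (x : Rvec R d) :
  \prod_(i < d) hgauss (tnth a i) (vcoord i x) =
  multi_hermite a x * heat_kernel 1 x.
Proof.
rewrite heat_kernelE// powR1 expr1n mul1r -big_split/=.
apply: eq_bigr => i _; rewrite mul1r hermiteE /hgauss.
by rewrite hornerC mul1r.
Qed.

Lemma monomial_scalev d s (a : d.-tuple nat) (y : Rvec R d) :
  monomial a (scalev s y) = s ^+ (\sum_(i < d) tnth a i) * monomial a y.
Proof.
rewrite -prodrXr /monomial -big_split/=; apply: eq_bigr => i _.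
by rewrite vcoord_scalev exprMn.
Qed.

Lemma enorm_scalev d s (y : Rvec R d) : 0 <= s ->
  enorm (scalev s y) = s * enorm y.
Proof.
move=> s0; rewrite /enorm; under eq_bigr do rewrite vcoord_scalev exprMn.
by rewrite -mulr_sumr sqrtrM ?sqr_ge0// sqrtr_sqr ger0_norm.
Qed.

Lemma taylor_term_scalev d j s (y z : Rvec R d) :
  taylor_term j (scalev s y) z = s ^+ j * taylor_term j y z.
Proof.
rewrite /taylor_term mulr_sumr; apply: eq_big_seq => a.
rewrite in_fset_set; last exact: finite_multi_index.
by rewrite inE => aj; rewrite monomial_scalev aj; ring.
Qed.

End heat_kernel_scaling.

(** * Integrals of finite sums *)

Section Rintegral_sum.
Context dT (T : measurableType dT) (R : realType) (mu : {measure set T -> \bar R}).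
Context (I : Type) (f : I -> T -> R).
Hypothesis intf : forall i, mu.-integrable setT (EFin \o f i).

Lemma integrable_sum_EFin (s : seq I) :
  mu.-integrable setT (EFin \o (fun x => \sum_(i <- s) f i x)).
Proof.
rewrite (_ : _ \o _ = fun x => (\sum_(i <- s) (EFin \o f i) x)%E).
  by apply: integrable_sum.
by apply/funext => x /=; rewrite sumEFin.
Qed.

Lemma Rintegral_sum (s : seq I) :
  \int[mu]_x (\sum_(i <- s) f i x) = \sum_(i <- s) \int[mu]_x f i x.
Proof.
elim: s => [|i s IH].
  under eq_Rintegral do rewrite big_nil.
  by rewrite big_nil /Rintegral integral0.
under eq_Rintegral do rewrite big_cons.
by rewrite RintegralD ?IH ?big_cons//; exact: integrable_sum_EFin.
Qed.

End Rintegral_sum.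

(** * Stability of the L1 norm *)

Section L1_perturbation.
Context dT (T : measurableType dT) (R : realType) (mu : {measure set T -> \bar R}).

(** The triangle inequality in additive form, meaningful for infinite norms as well. The final
    squeeze uses it in both directions. *)
Lemma integral_norm_le_perturb (f g : T -> R) (e : R) :
  measurable_fun setT f -> measurable_fun setT g ->
  (\int[mu]_x `|f x - g x|%:E <= e%:E)%E ->
  (\int[mu]_x `|f x|%:E <= \int[mu]_x `|g x|%:E + e%:E)%E.
Proof.
move=> mf mg fge.
have mn h : measurable_fun setT h ->
    measurable_fun setT (fun x : T => `|h x : R|%:E).
  by move=> mh; apply/measurable_EFinP/measurableT_comp.
have mfg : measurable_fun setT (fun x => f x - g x) by exact: measurable_funB.
apply: le_trans (leeD2l _ fge); rewrite -ge0_integralD//; [|exact: mn..].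
apply: ge0_le_integral => //; first exact: mn.
  by apply: emeasurable_funD; exact: mn.
move=> x _; rewrite -EFinD lee_fin.
by rewrite -{1}(subrK (g x) (f x)) addrC ler_normD.
Qed.

End L1_perturbation.

(** * Expansion of the smoothed measure in powers of s *)

Section smoothed_measure.
Context {R : realType} {d : nat}.
Implicit Types (mu : probability (Rvec R d) R) (s : R) (z : Rvec R d).

Lemma measurable_enorm : measurable_fun setT (@enorm R d).
Proof.
apply: (@measurableT_comp _ _ _ _ _ _ (@Num.sqrt R)).
  by apply: continuous_measurable_fun; exact: sqrt_continuous.
apply: measurable_sum => i; apply: measurable_funX; exact: measurable_vcoord.
Qed.

(** [|y^a|] is at most the norm of [y] to the power of the order of [a], hence at most 1 inside the
    unit ball and at most the [N]-th power of the norm outside. *)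
Lemma integrable_monomial mu N (a : d.-tuple nat) : finite_moment mu N ->
  (\sum_(i < d) tnth a i <= N)%N ->
  mu.-integrable setT (EFin \o monomial a).
Proof.
move=> muN aN.
have mN : measurable_fun setT (fun y : Rvec R d => (enorm y ^+ N)%:E).
  by apply/measurable_EFinP/measurable_funX; exact: measurable_enorm.
apply: (@le_integrable _ _ _ _ _ measurableT _
    (fun y => (1%:E + (enorm y ^+ N)%:E)%E)).
- by apply/measurable_EFinP; exact: measurable_monomial.
- move=> y _; rewrite -EFinD lee_fin [leRHS]ger0_norm ?addr_ge0 ?exprn_ge0 ?enorm_ge0//.
  rewrite /= /monomial normr_prod; under eq_bigr do rewrite normrX.
  apply: (@le_trans _ _ (enorm y ^+ (\sum_(i < d) tnth a i))).
    rewrite -prodrXr; apply: ler_prod => i _; rewrite exprn_ge0//=.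
    by rewrite lerXn2r ?nnegrE ?enorm_ge0// normr_vcoord_le.
  have [e1|e1] := leP (enorm y) 1.
    rewrite (@le_trans _ _ 1) ?exprn_ile1 ?enorm_ge0//.
    by rewrite lerDl exprn_ge0 ?enorm_ge0.
  by rewrite (le_trans (ler_weXn2l _ aN)) ?(ltW e1)// lerDr.
- apply: integrableD => //; first exact: finite_measure_integrable_cst.
  apply/integrableP; split => //.
  under eq_integral do rewrite gee0_abs ?lee_fin ?exprn_ge0 ?enorm_ge0//.
  exact: muN.
Qed.

(** The coefficient of [s^j] in the expansion of [smoothed mu s z]. *)
Definition hermite_coef mu j z : R :=
  \sum_(a <- fset_set (@multi_index d j))
    (multi_fact a)%:R^-1 * \int[mu]_y monomial a y *
    \prod_(i < d) hgauss (tnth a i) (vcoord i z).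

Lemma integrable_taylor_term mu N j z : finite_moment mu N -> (j <= N)%N ->
  mu.-integrable setT (fun y => (taylor_term j y z)%:E) /\
  \int[mu]_y taylor_term j y z = hermite_coef mu j z.
Proof.
move=> muN jN.
(* [Rintegral_sum] asks for integrability at every index, so the summand is set to 0 at orders above
   [N]; the sum over order [j <= N] is unchanged. *)
pose F (a : d.-tuple nat) y := if (\sum_(i < d) tnth a i <= N)%N then
  ((multi_fact a)%:R^-1 * \prod_(i < d) hgauss (tnth a i) (vcoord i z)) *
  monomial a y else 0.
have E y : taylor_term j y z =
    \sum_(a <- fset_set (@multi_index d j)) F a y.
  apply: eq_big_seq => a; rewrite in_fset_set; last exact: finite_multi_index.
  by rewrite inE /F => ->; rewrite jN mulrAC.
have intm a : mu.-integrable setT (EFin \o F a).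
  rewrite /F; case: (boolP (\sum_(i < d) tnth a i <= N)%N) => aN; last first.
    exact: integrable0.
  set c := _ * _.
  rewrite (_ : _ \o _ = fun y => (c%:E * (EFin \o monomial a) y)%E).
    by apply: integrableZl => //; exact: integrable_monomial aN.
  by apply/funext.
under eq_Rintegral do rewrite E.
split.
  apply: eq_integrable (integrable_sum_EFin intm (fset_set (multi_index j))).
    by [].
  by move=> y _; rewrite /= E.
rewrite (Rintegral_sum intm); apply: eq_big_seq => a.
rewrite in_fset_set; last exact: finite_multi_index.
rewrite inE /F => aj; rewrite aj jN RintegralZl//; first by rewrite mulrAC.
by apply: integrable_monomial muN _; rewrite aj.
Qed.

Lemma taylor_rem0_ge0 (y z : Rvec R d) : 0 <= taylor_rem 0 y z.
Proof.
rewrite /taylor_rem big_ord0 subr0; apply: prodr_ge0 => i _.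
by rewrite hgauss0_shift normal_pdf_ge0.
Qed.

Lemma integrable_taylor_rem0 mu s z :
  mu.-integrable setT (fun y => (taylor_rem 0 (scalev s y) z)%:E).
Proof.
have mt : measurable_fun setT (fun y : Rvec R d => taylor_rem 0 (scalev s y) z).
  apply: (measurableT_comp (measurable_fun_pair1 z (@measurable_taylor_rem R d 0))).
  exact: measurable_scalev.
apply: (@le_integrable _ _ _ _ _ measurableT _
    (fun y => ((normal_peak 1) ^+ d)%:E)).
- exact/measurable_EFinP.
- move=> y _; rewrite lee_fin ger0_norm ?taylor_rem0_ge0// ger0_norm; last first.
    by rewrite exprn_ge0// normal_peak_ge0.
  rewrite /taylor_rem big_ord0 subr0 -[in leRHS](card_ord d) -prodr_const.
  apply: ler_prod => i _; rewrite hgauss0_shift normal_pdf_ge0/=.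
  by rewrite normal_pdf_ub ?oner_eq0.
- exact: finite_measure_integrable_cst.
Qed.

Lemma measurable_taylor_rem_scalev m s : measurable_fun setT
  (fun p : Rvec R d * Rvec R d => taylor_rem m (scalev s p.2) p.1).
Proof.
apply: (@measurableT_comp _ _ _ _ _ _
    (fun p : Rvec R d * Rvec R d => taylor_rem m p.1 p.2) _
    (fun p : Rvec R d * Rvec R d => (scalev s p.2, p.1))).
  exact: measurable_taylor_rem.
apply: measurable_fun_pair; last exact: measurable_fst.
exact: measurableT_comp (@measurable_scalev R d s) measurable_snd.
Qed.

(* The Lebesgue density of Z + s Y, for Y of law mu and Z an independent
   standard Gaussian vector. *)
Definition smoothed mu s z : R := \int[mu]_y taylor_rem 0 (scalev s y) z.

Lemma measurable_smoothed mu s : measurable_fun setT (smoothed mu s).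
Proof.
(* The real integral is the [fine] of an extended one with nonnegative integrand, whose
   measurability in [z] is part of Tonelli. *)
apply: (measurableT_comp (@fine_measurable R setT measurableT)).
apply: (@measurable_fun_fubini_tonelli_F _ _ _ _ _ mu
    (fun p : Rvec R d * Rvec R d => (taylor_rem 0 (scalev s p.2) p.1)%:E)).
  by apply/measurable_EFinP; exact: measurable_taylor_rem_scalev.
by move=> p; rewrite lee_fin taylor_rem0_ge0.
Qed.

(** For [Y] of law [mu] and [Z] standard Gaussian, multiplying [Y + sqrt(t) Z] by [s = t^(-1/2)]
    gives [Z + s Y]; [s^d] is the Jacobian. *)
Lemma conv_density_heat mu t (x : Rvec R d) : 0 < t ->
  conv_density mu (heat_kernel t) x =
  (t `^ (- 2^-1)) ^+ d * smoothed mu (t `^ (- 2^-1)) (scalev (t `^ (- 2^-1)) x).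
Proof.
move=> t0; rewrite /conv_density.
under eq_Rintegral do rewrite heat_kernel_subv//.
by rewrite RintegralZl//; exact: integrable_taylor_rem0.
Qed.

Lemma measurable_hermite_coef mu j : measurable_fun setT (hermite_coef mu j).
Proof.
apply: measurable_sum => a; apply: measurable_funM => //.
exact: measurable_prod_hgauss.
Qed.

Definition smoothed_rem mu s N z :=
  smoothed mu s z - \sum_(j < N) s ^+ j * hermite_coef mu j z.

Lemma measurable_smoothed_rem mu s N :
  measurable_fun setT (smoothed_rem mu s N).
Proof.
apply: measurable_funB; first exact: measurable_smoothed.
apply: measurable_sum => j; apply: measurable_funM => //.
exact: measurable_hermite_coef.
Qed.

(** The Gaussian factor is bounded and the Taylor terms are integrable by the moment assumption, so
    the integral passes through the finite sum. *)
Lemma smoothed_remE mu s N z : finite_moment mu N ->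
  mu.-integrable setT (fun y => (taylor_rem N (scalev s y) z)%:E) /\
  smoothed_rem mu s N z = \int[mu]_y taylor_rem N (scalev s y) z.
Proof.
move=> muN.
have E y : taylor_rem N (scalev s y) z = taylor_rem 0 (scalev s y) z -
    \sum_(j < N) s ^+ j * taylor_term j y z.
  rewrite /taylor_rem big_ord0 subr0; congr (_ - _).
  by apply: eq_bigr => j _; rewrite taylor_term_scalev.
have intj (j : 'I_N) : mu.-integrable setT
    (EFin \o (fun y => s ^+ j * taylor_term j y z)).
  rewrite (_ : _ \o _ = fun y => ((s ^+ j)%:E * (taylor_term j y z)%:E)%E).
    apply: integrableZl => //.
    by apply: (integrable_taylor_term z muN _).1; exact: ltnW.
  by apply/funext.
have intS := integrable_sum_EFin intj (index_enum _).
under eq_Rintegral do rewrite E.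
split.
  apply: eq_integrable (integrableB _ (integrable_taylor_rem0 mu s z) intS) => //.
  by move=> y _; rewrite /= E EFinB.
rewrite RintegralB//; last exact: integrable_taylor_rem0.
congr (_ - _); rewrite (Rintegral_sum intj); apply: eq_bigr => j _.
have [h1 h2] := integrable_taylor_term z muN (ltnW (ltn_ord j)).
by rewrite RintegralZl// h2.
Qed.

(** Tonelli exchanges [z] and [y], so the bound of [taylor_rem_L1] at [s y] can be integrated
    against [mu]. *)
Lemma smoothed_rem_L1 mu N : finite_moment mu N ->
  exists2 C : R, 0 <= C & forall s, 0 <= s ->
  (\int[lebesgue_vec d]_z `|smoothed_rem mu s N z|%:E <= (C * s ^+ N)%:E)%E.
Proof.
move=> muN; have [C C0 HC] := @taylor_rem_L1 R d N.
have mN : measurable_fun setT (fun y : Rvec R d => (enorm y ^+ N)%:E).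
  by apply/measurable_EFinP/measurable_funX; exact: measurable_enorm.
have eN0 (y : Rvec R d) : (0 <= (enorm y ^+ N)%:E)%E.
  by rewrite lee_fin exprn_ge0 ?enorm_ge0.
have I0 : (0 <= \int[mu]_x (enorm x ^+ N)%:E)%E by exact: integral_ge0.
exists (C * fine (\int[mu]_x (enorm x ^+ N)%:E)%E).
  by rewrite mulr_ge0// fine_ge0.
move=> s s0.
pose f (p : Rvec R d * Rvec R d) := `|taylor_rem N (scalev s p.2) p.1|%:E.
have mf : measurable_fun setT f.
  by apply/measurable_EFinP/measurableT_comp => //; exact: measurable_taylor_rem_scalev.
have f0 p : (0 <= f p)%E by rewrite lee_fin.
apply: (@le_trans _ _ (\int[lebesgue_vec d]_z \int[mu]_y f (z, y))%E).
  apply: ge0_le_integral => //.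
  - by apply/measurable_EFinP/measurableT_comp => //; exact: measurable_smoothed_rem.
  - exact: measurable_fun_fubini_tonelli_F.
  - move=> z _; have [int ->] := smoothed_remE s z muN.
    rewrite EFin_normr_Rintegral//; apply: le_abse_integral => //.
    exact: measurable_int int.
rewrite (fubini_tonelli f)//.
apply: (@le_trans _ _ (\int[mu]_y ((C * s ^+ N)%:E * (enorm y ^+ N)%:E))%E).
  apply: ge0_le_integral => //.
  - by move=> y _; exact: integral_ge0.
  - exact: (measurable_fun_fubini_tonelli_G f mf f0).
  - exact: measurable_funeM.
  - move=> y _; have := HC (scalev s y).
    by rewrite enorm_scalev// exprMn mulrA EFinM.
rewrite ge0_integralZl//; last by rewrite lee_fin mulr_ge0// exprn_ge0.
by rewrite mulrAC [leRHS]EFinM fineK// ge0_fin_numE.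
Qed.

End smoothed_measure.

(** * The limit as t tends to infinity *)

Section limit.
Context {R : realType} {d : nat}.
Implicit Types (mu nu : probability (Rvec R d) R).

Lemma moment_law dT (T : measurableType dT) (P : probability T R)
    (X : {RV P >-> Rvec R d}) mu N (a : d.-tuple nat) :
  has_law X mu -> finite_moment mu N -> (\sum_(i < d) tnth a i <= N)%N ->
  fine (moment X a) = \int[mu]_y monomial a y.
Proof.
move=> Xmu muN aN; congr fine; rewrite /moment expectation.unlock.
have mm := @measurable_monomial R d a.
have mE : measurable_fun setT (EFin \o @monomial d R a) by exact/measurable_EFinP.
have /integrableP[_ intm] := integrable_monomial muN aN.
transitivity (\int[distribution P X]_y (monomial a y)%:E)%E; last first.
  by apply: eq_measure_integral => A mA _; exact: Xmu.
(* Integrability of the monomial of [X] is inherited from [mu] by the nonnegative change of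
   variables for its absolute value. *)
rewrite (integral_distribution mE)//; apply/integrableP; split.
  by apply: (measurableT_comp mE); exact: measurable_funP.
rewrite -(ge0_integral_distribution X (f := fun y => `|(monomial a y)%:E|%E))//.
  rewrite (eq_measure_integral mu)// => A mA _; exact: Xmu.
exact: measurableT_comp.
Qed.

Lemma cvg_powRN_half : (t : R) `^ (- 2^-1) @[t --> +oo] --> (0 : R).
Proof.
apply/cvgrPdist_le => e e0; near=> t.
have t0 : 0 < t by near: t; exact: nbhs_pinfty_gt.
rewrite sub0r normrN ger0_norm ?powR_ge0// powRN powR12_sqrt ?ltW//.
rewrite -[ltRHS]invrK ltf_pV2 ?posrE ?invr_gt0 ?sqrtr_gt0//.
(* The threshold for [t] is [e^-1 ^+ 2]. *)
rewrite -[ltLHS]ger0_norm ?invr_ge0 ?ltW// -sqrtr_sqr ltr_sqrt//.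
by near: t; apply: nbhs_pinfty_gt; rewrite num_real.
Unshelve. all: by end_near. Qed.

(** The substitution [z = s x] with [s = t^(-1/2)] absorbs the factor [s^d] of both densities. *)
Lemma d_TV_heat mu nu (t : R) : 0 < t ->
  d_TV (conv_density mu (heat_kernel t)) (conv_density nu (heat_kernel t)) =
  ((2^-1)%:E * \int[lebesgue_vec d]_z
    `|smoothed mu (t `^ (- 2^-1)) z - smoothed nu (t `^ (- 2^-1)) z|%:E)%E.
Proof.
move=> t0; rewrite /d_TV; apply: congr1.
have s0 : 0 < t `^ (- 2^-1) by exact: powR_gt0.
set s := t `^ _ in s0 *.
pose F z : \bar R := `|smoothed mu s z - smoothed nu s z|%:E.
have mF : measurable_fun setT F.
  apply/measurable_EFinP/measurableT_comp => //.
  by apply: measurable_funB; exact: measurable_smoothed.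
have F0 z : (0 <= F z)%E by rewrite lee_fin.
rewrite -[RHS]/(\int[lebesgue_vec d]_z F z)%E (ge0_integral_scale_vec s0 mF)//.
have sd : (0 <= (s ^+ d)%:E)%E by rewrite lee_fin exprn_ge0// ltW.
transitivity (\int[lebesgue_vec d]_x ((s ^+ d)%:E * F (scalev s x)))%E.
  apply: eq_integral => x _.
  rewrite !conv_density_heat// -/s -mulrBr normrM.
  by rewrite (ger0_norm (exprn_ge0 d (ltW s0))) EFinM.
have mFs : measurable_fun setT (fun x => F (scalev s x)).
  exact: (measurableT_comp mF (@measurable_scalev R d s)).
by rewrite (ge0_integralZl _ measurableT mFs).
Qed.

Lemma cvg_scaled_d_TV mu nu n :
  finite_moment mu n.+2 -> finite_moment nu n.+2 ->
  (forall j z, (j <= n)%N -> hermite_coef mu j z = hermite_coef nu j z) ->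
  ((t `^ (n.+1%:R / 2))%:E *
     d_TV (conv_density mu (heat_kernel t)) (conv_density nu (heat_kernel t)))%E
    @[t --> +oo%R] -->
  ((2^-1)%:E * \int[lebesgue_vec d]_z
    `|hermite_coef mu n.+1 z - hermite_coef nu n.+1 z|%:E)%E.
Proof.
move=> mum num eqj.
have [C1 C10 H1] := smoothed_rem_L1 mum.
have [C2 C20 H2] := smoothed_rem_L1 num.
pose L z := hermite_coef mu n.+1 z - hermite_coef nu n.+1 z.
have mL : measurable_fun setT L.
  by apply: measurable_funB; exact: measurable_hermite_coef.
pose D s z := s ^- n.+1 * (smoothed mu s z - smoothed nu s z).
have mD s : measurable_fun setT (D s).
  by apply: measurable_funM => //; apply: measurable_funB; exact: measurable_smoothed.
have mrem m s : measurable_fun setT (fun z => `|smoothed_rem m s n.+2 z|%:E).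
  apply/measurable_EFinP/measurableT_comp => //; exact: measurable_smoothed_rem.
(* The orders up to [n] cancel by [eqj], and order [n+1] divided by [s^(n+1)] is [L]; only the
   remainders of order [n+2] are left. *)
have DL s z : 0 < s -> D s z - L z =
    s ^- n.+1 * (smoothed_rem mu s n.+2 z - smoothed_rem nu s n.+2 z).
  move=> s0; rewrite /D /smoothed_rem ![\sum_(j < n.+2) _]big_ord_recr/=.
  have -> : \sum_(j < n.+1) s ^+ j * hermite_coef mu j z =
      \sum_(j < n.+1) s ^+ j * hermite_coef nu j z.
    by apply: eq_bigr => j _; rewrite eqj// -ltnS.
  rewrite /L; have := @mulVf _ (s ^+ n.+1); rewrite expf_neq0 ?gt_eqF// => /(_ isT).
  set v := s ^- n.+1; set w := s ^+ n.+1; move=> vw.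
  rewrite -[hermite_coef mu n.+1 z - hermite_coef nu n.+1 z]mul1r -vw; ring.
have DLle s : 0 < s ->
    (\int[lebesgue_vec d]_z `|D s z - L z|%:E <= ((C1 + C2) * s)%:E)%E.
  move=> s0.
  have v0 : 0 <= s ^- n.+1 by rewrite invr_ge0 exprn_ge0// ltW.
  apply: (@le_trans _ _ (\int[lebesgue_vec d]_z ((s ^- n.+1)%:E *
      (`|smoothed_rem mu s n.+2 z|%:E + `|smoothed_rem nu s n.+2 z|%:E)))%E).
    apply: ge0_le_integral => //.
    - by apply/measurable_EFinP/measurableT_comp => //; exact: measurable_funB.
    - by apply: measurable_funeM; apply: emeasurable_funD; exact: mrem.
    - move=> z _; rewrite DL// -EFinD -EFinM lee_fin normrM.
      by rewrite (ger0_norm v0) ler_wpM2l ?ler_normB.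
  rewrite ge0_integralZl//; last 2 first.
  - apply: emeasurable_funD; exact: mrem.
  - by move=> z _; rewrite adde_ge0.
  rewrite ge0_integralD//; [|exact: mrem..].
  apply: (@le_trans _ _ ((s ^- n.+1)%:E *
      ((C1 * s ^+ n.+2)%:E + (C2 * s ^+ n.+2)%:E))%E).
    apply: lee_wpmul2l; first by rewrite lee_fin.
    by apply: leeD; [apply: H1|apply: H2]; exact: ltW.
  rewrite -EFinD -EFinM lee_fin -mulrDl [s ^+ n.+2]exprS [leLHS]mulrC -!mulrA.
  by rewrite mulfV ?mulr1// expf_neq0// gt_eqF.
(* [I] stays an extended real; adding or subtracting the finite error is defined whatever its
   value. *)
pose I := (\int[lebesgue_vec d]_z `|L z|%:E)%E.
have cvge : ((C1 + C2) * t `^ (- 2^-1))%:E @[t --> +oo] --> (0 : \bar R).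
  apply: cvg_EFin; first exact: nearW.
  rewrite /comp/= -[X in _ --> X](mulr0 (C1 + C2)).
  by apply: cvgMr; exact: cvg_powRN_half.
have I0 : (0 <= I)%E by exact: integral_ge0.
have cI : ((fun=> I) t + ((C1 + C2) * t `^ (- 2^-1))%:E)%E @[t --> +oo] --> I.
  rewrite -[X in _ --> X]adde0; apply: cvgeD => //; last exact: cvg_cst.
  by rewrite fin_num_adde_defl.
have cI' : ((fun=> I) t - ((C1 + C2) * t `^ (- 2^-1))%:E)%E @[t --> +oo] --> I.
  rewrite -[X in _ --> X]sube0; apply: cvgeB => //; last exact: cvg_cst.
  by rewrite fin_num_adde_defl.
suff cD : (\int[lebesgue_vec d]_z `|D (t `^ (- 2^-1)) z|%:E)%E @[t --> +oo] --> I.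
  have := cvgeZl (y := (2^-1)%:E) isT cD.
  apply: cvg_trans; apply: near_eq_cvg; near=> t.
  have t0 : 0 < t by near: t; exact: nbhs_pinfty_gt.
  rewrite /= d_TV_heat// muleCA; apply: congr1.
  (* The normalisation in [t] is the division by [s^(n+1)] in [D]. *)
  have st : t `^ (n.+1%:R / 2) = (t `^ (- 2^-1)) ^- n.+1.
    by rewrite powRN exprVn invrK -powR_mulrn ?powR_ge0// -powRrM mulrC.
  rewrite st.
  have v0 : 0 <= (t `^ (- 2^-1)) ^- n.+1 by rewrite invr_ge0 exprn_ge0// powR_ge0.
  transitivity (\int[lebesgue_vec d]_z (((t `^ (- 2^-1)) ^- n.+1)%:E *
     `|smoothed mu (t `^ (- 2^-1)) z - smoothed nu (t `^ (- 2^-1)) z|%:E))%E.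
    by apply: eq_integral => z _; rewrite /D normrM ger0_norm// EFinM.
  apply: (ge0_integralZl _ measurableT) => //.
  apply/measurable_EFinP/measurableT_comp => //.
  by apply: measurable_funB; exact: measurable_smoothed.
(* The norms of [D s] and [L] differ by at most the error [(C1 + C2) s], which tends to 0. *)
apply: squeeze_cvge cI' cI; near=> t.
have t0 : 0 < t by near: t; exact: nbhs_pinfty_gt.
have s0 : 0 < t `^ (- 2^-1) by exact: powR_gt0.
apply/andP; split; last first.
  exact: (integral_norm_le_perturb (mD _) mL (DLle _ s0)).
rewrite leeBlDr//; apply: (integral_norm_le_perturb mL (mD _)).
under eq_integral do rewrite distrC.
exact: DLle.
Unshelve. all: by end_near. Qed.

Lemma integral_std_gaussian (f : Rvec R d -> \bar R) :
  measurable_fun setT f -> (forall x, 0 <= f x)%E ->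
  (\int[std_gaussian]_x f x =
   \int[lebesgue_vec d]_x (f x * (heat_kernel 1 x)%:E))%E.
Proof.
move=> mf f0; apply: ge0_integral_density => //.
- exact: measurable_heat_kernel.
- by move=> x; exact: heat_kernel_ge0.
Qed.

Lemma measurable_multi_hermite (a : d.-tuple nat) :
  measurable_fun setT (@multi_hermite R d a).
Proof.
apply: measurable_prod => i _.
apply: (@measurableT_comp _ _ _ _ _ _ (hermite (tnth a i))).
  rewrite (_ : hermite _ = horner (hermite_poly (tnth a i))).
    by apply: continuous_measurable_fun; exact: continuous_horner.
  by apply/funext => x; rewrite hermiteE.
exact: measurable_vcoord.
Qed.

End limit.

Theorem theorem2p6 (R : realType) (d : nat) (mu nu : probability (Rvec R d) R)
    (dX : measure_display) (TX : measurableType dX) (PX : probability TX R)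
    (X : {RV PX >-> Rvec R d})
    (dY : measure_display) (TY : measurableType dY) (PY : probability TY R)
    (Y : {RV PY >-> Rvec R d})
    (n : nat)
    (Xmu : has_law X mu) (Ynu : has_law Y nu)
    (mu_moment : finite_moment mu n.+2) (nu_moment : finite_moment nu n.+2)
    (Mn : condition_M X Y n) :
  ((t `^ (n.+1%:R / 2))%:E *
     d_TV (conv_density mu (heat_kernel t)) (conv_density nu (heat_kernel t)))%E
    @[t --> +oo%R] -->
  ((2^-1)%:E * \int[std_gaussian]_x
     `| \sum_(a \in multi_index n.+1)
          (multi_fact a)%:R^-1 * (fine (moment X a) - fine (moment Y a)) *
          multi_hermite a x |%:E)%E.
Proof.
have momX a : (\sum_(i < d) tnth a i <= n.+2)%N ->
    fine (moment X a) = \int[mu]_y monomial a y.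
  exact: moment_law.
have momY a : (\sum_(i < d) tnth a i <= n.+2)%N ->
    fine (moment Y a) = \int[nu]_y monomial a y.
  exact: moment_law.
(* The moments of order [j <= n] agree by [Mn], hence so do the coefficients of these orders. *)
have eqj j z : (j <= n)%N -> hermite_coef mu j z = hermite_coef nu j z.
  move=> jn; apply: eq_big_seq => a.
  rewrite in_fset_set; last exact: finite_multi_index.
  rewrite inE => aj; have aN : (\sum_(i < d) tnth a i <= n.+2)%N.
    by rewrite aj (leq_trans jn)// -addn2 leq_addr.
  by rewrite -(momX _ aN) -(momY _ aN) (Mn.1 _ _ jn aj).
set RHS := (X in _ --> X).
suff -> : RHS = ((2^-1)%:E * \int[lebesgue_vec d]_z
    `|hermite_coef mu n.+1 z - hermite_coef nu n.+1 z|%:E)%E.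
  exact: cvg_scaled_d_TV mu_moment nu_moment eqj.
have hE (z : Rvec R d) : \sum_(a \in multi_index n.+1)
    (multi_fact a)%:R^-1 * (fine (moment X a) - fine (moment Y a)) *
    multi_hermite a z =
  \sum_(a <- fset_set (@multi_index d n.+1))
    (multi_fact a)%:R^-1 * (fine (moment X a) - fine (moment Y a)) *
    multi_hermite a z.
  by rewrite fsbig_finite//; exact: finite_multi_index.
rewrite /RHS; apply: congr1; rewrite integral_std_gaussian//; last first.
  apply/measurable_EFinP/measurableT_comp => //.
  under eq_fun do rewrite hE.
  apply: measurable_sum => a; apply: measurable_funM => //.
  exact: measurable_multi_hermite.
apply: eq_integral => z _; rewrite hE -EFinM; congr EFin.
(* The nonnegative Gaussian density moves inside the absolute value, where it turns the Hermite
   polynomials into products of [hgauss]. *)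
rewrite -[heat_kernel 1 z](ger0_norm (heat_kernel_ge0 _ _)) -normrM.
congr `|_|; rewrite mulr_suml /hermite_coef -sumrB; apply: eq_big_seq => a.
rewrite in_fset_set; last exact: finite_multi_index.
rewrite inE => aj; have aN : (\sum_(i < d) tnth a i <= n.+2)%N by rewrite aj.
by rewrite momX// momY// prod_hgaussE; ring.
Qed.
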